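(* Let $k\ge2$ and $n\ge1$ be integers with $k>2^n$. Let $\mathbf s_j=(2^k-1)2^{n+j}-1$ for $j\in\mathbb N$ and let $S_n=\langle\{\mathbf s_j:j\in\mathbb N\}\rangle$, which is a numerical semigroup. Then $$\max\mathrm{Ap}(S_n,\mathbf s_0)=2\mathbf s_{n+k-2^n-1}+\sum_{j=n+k-2^n}^{n+k-1}\mathbf s_j$$ and the Frobenius number of $S_n$ is $$\mathrm F(S_n)=2^{2n+2k}-2^{2n+k}-2^{n+k}-1.$$
   Context: $\mathbb N=\{0,1,2,\ldots\}$. For $A\subseteq\mathbb N$, $\langle A\rangle$ is the submonoid of $(\mathbb N,+)$ generated by $A$. A numerical semigroup is a submonoid $S$ of $\mathbb N$ with finite complement; its Frobenius number $\mathrm F(S)$ is the largest element of $\mathbb N\setminus S$. For $x\in S\setminus\{0\}$, the Apéry set is $\mathrm{Ap}(S,x)=\{y\in S:y-x\notin S\}$. *)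

(* Defs.v *)
From mathcomp Require Import all_boot all_order.
From mathcomp Require Import boolp classical_sets functions cardinality.

Set Implicit Arguments.
Unset Strict Implicit.
Unset Printing Implicit Defensive.

Local Open Scope classical_set_scope.
Local Open Scope nat_scope.

Definition submonoid (S : set nat) : Prop :=
  S 0 /\ (forall x y, S x -> S y -> S (x + y)).

Definition generated (A : set nat) : set nat := smallest submonoid A.

Definition numerical_semigroup (S : set nat) : Prop :=
  submonoid S /\ finite_set (~` S).

Definition is_max (A : set nat) (m : nat) : Prop :=
  A m /\ (forall y, A y -> y <= m).

Definition is_frobenius (S : set nat) (f : nat) : Prop := is_max (~` S) f.

(* [y - x] is an integer difference: for [y < x] it is negative, hence not in
   [S]. The guard [x <= y] keeps truncated subtraction from yielding [0]. *)
Definition Apery (S : set nat) (x : nat) : set nat :=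
  [set y | S y /\ ~ (x <= y /\ S (y - x))].

Definition sgen (k n j : nat) : nat := (2 ^ k - 1) * 2 ^ (n + j) - 1.

Definition Sgen (k n : nat) : set nat := generated (range (sgen k n)).

(* Main.v *)
Require Import Defs.
From mathcomp Require Import all_boot all_order.
From mathcomp Require Import boolp classical_sets functions cardinality.
From mathcomp Require Import zify.

Set Implicit Arguments.
Unset Strict Implicit.
Unset Printing Implicit Defensive.

Local Open Scope nat_scope.

(** Write [s := s_0] and [g W := logn 2 W`!], which is [W] minus its binary
    digit sum. Since [s_j = s * 2 ^ j + g (2 ^ j)], a sum of [t] generators is
    [s * W + (W - t)] where [W] is a sum of [t] powers of [2]; this is possible
    exactly when [t] lies between the digit sum of [W] and [W]. So [S_n] is the
    union of the intervals [[s * W, s * W + g W]], and as [g] is monotone,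
    [x] is in [S_n] if and only if [x %% s <= g (x %/ s)].
    As [s = 2 ^ (n + k) - 2 ^ n - 1], the hypothesis [2 ^ n < k] says that
    [g (2 ^ (n + k) - 1) < s - 1 <= g (2 ^ (n + k))], so that the largest gap is
    [s * 2 ^ (n + k) - 1]. *)

(** Holds because the binomial coefficient is an integer. This superadditivity of [g] makes the
    union of intervals closed under addition. *)
Lemma logn2_factD a b : logn 2 a`! + logn 2 b`! <= logn 2 (a + b)`!.
Proof.
rewrite -lognM ?fact_gt0 // dvdn_leq_log ?fact_gt0 //.
rewrite -(@bin_fact (a + b) a) ?leq_addr // addKn.
exact: dvdn_mull.
Qed.

Lemma leq_logn2_fact a b : a <= b -> logn 2 a`! <= logn 2 b`!.
Proof.
by move=> /subnKC <-; apply: leq_trans (logn2_factD _ _); rewrite leq_addr.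
Qed.

Lemma logn2_fact_doubleS m : logn 2 (m.*2.+1)`! = logn 2 (m.*2)`!.
Proof.
by rewrite factS lognM ?fact_gt0 // lognE dvdn2 /= odd_double.
Qed.

Lemma logn2_fact_double m : logn 2 (m.*2)`! = m + logn 2 m`!.
Proof.
elim: m => [|m IHm]; first by rewrite fact0 logn1.
rewrite doubleS factS lognM ?fact_gt0 // logn2_fact_doubleS IHm.
rewrite -doubleS -mul2n lognM // (@pfactorK 2 1) // factS lognM ?fact_gt0 //.
lia.
Qed.

Lemma logn2_fact_exp2 m : logn 2 (2 ^ m)`! = 2 ^ m - 1.
Proof.
elim: m => [|m IHm]; first by rewrite logn1.
rewrite expnS mul2n logn2_fact_double IHm; have := expn_gt0 2 m; lia.
Qed.

Lemma logn2_fact_pred_exp2 m : logn 2 (2 ^ m - 1)`! = 2 ^ m - 1 - m.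
Proof.
have := logn2_fact_exp2 m; have m_gt0 : 0 < 2 ^ m by rewrite expn_gt0.
rewrite -{1}(prednK m_gt0) factS prednK // lognM ?fact_gt0 // pfactorK //.
rewrite subn1; lia.
Qed.

(** An odd [W > 1] sheds a summand [1], as its odd last factor adds nothing to the valuation; for
    even [W], double a splitting of [W./2]. By such splittings the interval of [W] is a sum of the
    intervals of [a] and [b]. *)
Lemma logn2_fact_split W : 0 < W ->
  (exists m, W = 2 ^ m) \/
  exists a b, [/\ 0 < a, 0 < b, W = a + b &
                  logn 2 W`! = logn 2 a`! + logn 2 b`!].
Proof.
elim/ltn_ind: W => W IHW W_gt0.
have := odd_double_half W; case: (odd W) => /= W_half.
- have [h0|h_gt0] := posnP W./2; first by left; exists 0; lia.
  right; exists (W./2).*2, 1; split; [lia | by [] | lia |].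
  by rewrite -[in LHS]W_half add1n logn2_fact_doubleS logn1 addn0.
- have [||[m mE]|[a [b [a_gt0 b_gt0 abE fE]]]] := IHW W./2; [lia | lia | |].
  + by left; exists m.+1; rewrite expnS; lia.
  + right; exists a.*2, b.*2; split; [lia.. |].
    rewrite -[in LHS]W_half add0n !logn2_fact_double fE; lia.
Qed.

Lemma generated_incl (A : set nat) x : A x -> generated A x.
Proof. by move=> Ax B [_]; apply. Qed.

Lemma generated0 (A : set nat) : generated A 0.
Proof. by move=> B [[B0 _] _]. Qed.

Lemma generatedD (A : set nat) x y :
  generated A x -> generated A y -> generated A (x + y).
Proof.
by move=> Ax Ay B BA; have [[_ BD] _] := BA; apply: BD; [exact: Ax | exact: Ay].
Qed.

Lemma is_frobenius_Apery (S : set nat) x f :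
  0 < x -> is_frobenius S f -> is_max (Apery S x) (f + x).
Proof.
move=> x_gt0 [Sf f_max].
have S_gt y : f < y -> S y.
  by move=> fy; apply: contrapT => /f_max; rewrite leqNgt fy.
split; first by split; [apply: S_gt; lia | rewrite addnK => -[]].
move=> y [_ Sy]; rewrite leqNgt; apply/negP => fxy.
by apply: Sy; split; [lia | apply: S_gt; lia].
Qed.

Lemma is_frobenius_finite (S : set nat) f :
  is_frobenius S f -> finite_set (~` S)%classic.
Proof.
move=> [_ f_max]; apply: (sub_finite_set _ (finite_II f.+1)) => y /f_max /=.
by rewrite ltnS.
Qed.

Lemma sgenE k n j :
  0 < sgen k n 0 -> sgen k n j = sgen k n 0 * 2 ^ j + (2 ^ j - 1).
Proof.
rewrite /sgen addn0 expnD; have := expn_gt0 2 j; nia.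
Qed.

Lemma Sgen_interval k n W r : 0 < sgen k n 0 ->
  r <= logn 2 W`! -> Sgen k n (sgen k n 0 * W + r).
Proof.
move=> s_gt0; elim/ltn_ind: W r => W IHW r.
have [->|W_gt0] := posnP W.
  rewrite logn1 leqn0 => /eqP ->; rewrite muln0; exact: generated0.
have split a b : 0 < a -> 0 < b -> W = a + b ->
    r <= logn 2 a`! + logn 2 b`! -> Sgen k n (sgen k n 0 * W + r).
  move=> a_gt0 b_gt0 WE rab; pose c := minn r (logn 2 a`!).
  have -> : sgen k n 0 * W + r =
      (sgen k n 0 * a + c) + (sgen k n 0 * b + (r - c)) by rewrite WE /c; lia.
  by apply: generatedD; apply: IHW; rewrite /c; lia.
have [[m WE]|[a [b [a_gt0 b_gt0 WE ->]]]] := logn2_fact_split W_gt0; last first.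
  exact: split.
(* The right endpoint [r = 2 ^ m - 1] is the generator [s_m] itself. A smaller [r] can be shared
   between two halves [2 ^ (m - 1)], because [g (2 ^ m) = 2 * g (2 ^ (m - 1)) + 1]. *)
rewrite WE logn2_fact_exp2 leq_eqVlt => /orP[/eqP ->|r_lt].
  by rewrite -sgenE //; apply: generated_incl; exists m.
case: m WE r_lt => [|m] WE r_lt; first by [].
rewrite -WE; apply: (split (2 ^ m) (2 ^ m)); rewrite ?expn_gt0 //.
  by rewrite WE expnS; lia.
by move: r_lt; rewrite !logn2_fact_exp2 expnS; lia.
Qed.

Lemma Sgen_interval_inv k n x : 0 < sgen k n 0 -> Sgen k n x ->
  exists W r, x = sgen k n 0 * W + r /\ r <= logn 2 W`!.
Proof.
move=> s_gt0; apply: (smallest_sub (X :=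
  [set x | exists W r, x = sgen k n 0 * W + r /\ r <= logn 2 W`!]%classic)).
  split; first by exists 0, 0; rewrite muln0.
  move=> _ _ [W [r [-> rW]]] [V [q [-> qV]]]; exists (W + V), (r + q).
  split; first by lia.
  by apply: leq_trans (logn2_factD _ _); exact: leq_add.
by move=> _ [j _ <-]; exists (2 ^ j), (2 ^ j - 1); rewrite logn2_fact_exp2 -sgenE.
Qed.

Lemma mem_Sgen k n x : 0 < sgen k n 0 ->
  Sgen k n x <-> x %% sgen k n 0 <= logn 2 (x %/ sgen k n 0)`!.
Proof.
move=> s_gt0; split; last first.
  by move=> /(Sgen_interval s_gt0); rewrite mulnC -divn_eq.
move=> /(Sgen_interval_inv s_gt0)[W [r [xE rW]]].
(* Since [r] may exceed [s], [W] only bounds the quotient from below; monotonicity of [g] bridges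
   the difference. *)
have leW : W <= x %/ sgen k n 0 by rewrite leq_divRL // mulnC xE leq_addr.
apply: leq_trans (leq_logn2_fact leW); apply: leq_trans rW.
by rewrite xE mulnC modnMDl leq_mod.
Qed.

(** The candidate has quotient [q] and the largest residue [s - 1], which [g q] does not reach. A
    larger number has quotient at least [q + 1], where [g] covers every residue. *)
Lemma is_frobenius_Sgen k n q : 0 < sgen k n 0 ->
    logn 2 q`! < (sgen k n 0).-1 <= logn 2 q.+1`! ->
  is_frobenius (Sgen k n) (sgen k n 0 * q.+1 - 1).
Proof.
move=> s_gt0 /andP[lt_q le_q]; set s := sgen k n 0 in s_gt0 lt_q le_q *.
have -> : s * q.+1 - 1 = q * s + s.-1 by nia.
split.
  rewrite /setC /= => /(mem_Sgen _ s_gt0).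
  rewrite -/s modnMDl divnMDl // modn_small ?divn_small ?addn0; lia.
move=> y; rewrite leqNgt => Sy; apply/negP => lt_y; apply/Sy/(mem_Sgen _ s_gt0).
rewrite -/s; have lt_mod : y %% s < s by rewrite ltn_mod.
have q_lt : q.+1 <= y %/ s by rewrite leq_divRL //; nia.
by apply: leq_trans (leq_logn2_fact q_lt); lia.
Qed.

(** A geometric sum, since [s_j + 1 = (s + 1) * 2 ^ j]. *)
Lemma sum_sgen k n a b : 0 < sgen k n 0 -> a <= b ->
  \sum_(a <= j < b) sgen k n j + (b - a) =
  (sgen k n 0).+1 * (2 ^ b - 2 ^ a).
Proof.
move=> s_gt0; elim: b => [|b IHb].
  by rewrite leqn0 => /eqP ->; rewrite big_geq // !subnn muln0.
rewrite leq_eqVlt => /orP[/eqP ->|]; first by rewrite big_geq // !subnn muln0.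
rewrite ltnS => le_ab; rewrite big_nat_recr //= (sgenE b s_gt0).
have := IHb le_ab; have : 2 ^ a <= 2 ^ b by rewrite leq_exp2l.
rewrite expnS; have := expn_gt0 2 b; nia.
Qed.

Theorem mainTheorem9 (k n : nat) (hk : 2 <= k) (hn : 1 <= n) (hkn : 2 ^ n < k) :
  [/\ numerical_semigroup (Sgen k n),
      is_max (Apery (Sgen k n) (sgen k n 0))
        (2 * sgen k n (n + k - 2 ^ n - 1)
           + \sum_(n + k - 2 ^ n <= j < n + k) sgen k n j)
    & is_frobenius (Sgen k n)
        (2 ^ (2 * n + 2 * k) - 2 ^ (2 * n + k) - 2 ^ (n + k) - 1)].
Proof.
have sE : sgen k n 0 = 2 ^ (n + k) - 2 ^ n - 1.
  by rewrite /sgen addn0 mulnBl mul1n expnD mulnC.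
have n_gt0 : 0 < 2 ^ n by rewrite expn_gt0.
have ltk : k < 2 ^ k by apply: ltn_expl.
have le4 : 2 ^ n * 4 <= 2 ^ (n + k).
  by rewrite expnD leq_mul2l (@leq_exp2l 2 2) // hk orbT.
have s_gt0 : 0 < sgen k n 0 by rewrite sE; lia.
have frob : is_frobenius (Sgen k n) (sgen k n 0 * 2 ^ (n + k) - 1).
  rewrite -[2 ^ (n + k)]prednK; last by lia.
  apply: is_frobenius_Sgen => //.
  rewrite prednK ?logn2_fact_exp2; last by lia.
  (* The strict inequality amounts to [2 ^ n + 1 < n + k]. *)
  rewrite -subn1 logn2_fact_pred_exp2 sE; lia.
split.
- split; last exact: is_frobenius_finite frob.
  by split; [exact: generated0 | exact: generatedD].
(* The doubled generator completes the geometric sum: both sides equal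
   [(s + 1) * 2 ^ (n + k) - 2 ^ n - 2]. *)
- have := is_frobenius_Apery s_gt0 frob; congr is_max.
  have le_ab : n + k - 2 ^ n <= n + k by rewrite leq_subr.
  have := sum_sgen s_gt0 le_ab; rewrite (sgenE (_ - 1) s_gt0).
  have : 2 ^ (n + k - 2 ^ n) <= 2 ^ (n + k) by rewrite leq_exp2l.
  have -> : 2 ^ (n + k - 2 ^ n) = 2 * 2 ^ (n + k - 2 ^ n - 1).
    by rewrite -expnS; congr (2 ^ _); lia.
  have := expn_gt0 2 (n + k - 2 ^ n - 1).
  have -> : n + k - (n + k - 2 ^ n) = 2 ^ n by lia.
  move: (2 ^ (n + k - 2 ^ n - 1)) (\sum_(_ <= j < _) _) => A Z.
  by rewrite mulnBr !mulSn => *; nia.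
- congr is_frobenius: frob; rewrite sE !mulnBl mul1n -!expnD.
  by congr (2 ^ _ - 2 ^ _ - _ - _); lia.
Qed.
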